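(* Let $H$ be a cosovereign Hopf algebra over a field $k$ with sovereign character $u$, and let $A$ be a finite dimensional right $H$-comodule algebra. Let $\mathcal{E}(A)=A\oplus F(A^* )$, with the direct sum structure of a right $H$-comodule, and with the algebra structure of the trivial extension of $A$ and the $A,A$-bimodule $F(A^* )$, i.e. $$(a,a^* )(b,b^* )=(ab,\;a*b^*+a^*b),\qquad a,b\in A,\ a^*,b^*\in A^*.$$ Then $\mathcal{E}(A)$ is a right $H$-comodule algebra which is $(H,u)$-symmetric.
   Context: $k$ is a field, $H$ is a Hopf algebra over $k$ with antipode $S$, and $H^*$ is its dual algebra (convolution product). A right $H$-comodule algebra is an algebra $A$ in the monoidal category $\mathcal{M}^H$ of right $H$-comodules; its coaction is written $a\mapsto\sum a_0\otimes a_1\in A\otimes H$. Any right $H$-comodule $M$ is a left $H^*$-module by $h^*\cdot m=\sum h^*(m_1)m_0$. $H$ is cosovereign with sovereign character $u$ if $u:H\to k$ is an algebra morphism with $S^2(h)=\sum u^{-1}(h_1)u(h_3)h_2$ for all $h\in H$, where $u^{-1}=u\circ S$ is the convolution inverse of $u$. ${}_A\mathcal{M}^H_A$ denotes the category of $A,A$-bimodules in $\mathcal{M}^H$ (right $H$-comodules with an $A,A$-bimodule structure such that $\rho(ma)=\sum m_0a_0\otimes m_1a_1$ and $\rho(am)=\sum a_0m_0\otimes a_1m_1$). For a finite dimensional right $H$-comodule algebra $A$, the dual $A^*$ is a right $H$-comodule with coaction $a^*\mapsto\sum a^*_0\otimes a^*_1$ determined by $\sum a^*_0(a)a^*_1=\sum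 a^*(a_0)S(a_1)$ for all $a\in A$. Let $F(A^* )$ be $A^*$ with this coaction, with the usual right $A$-action $(a^*a)(b)=a^*(ab)$, and with the left $A$-action $a*a^*$ given by $(a*a^* )(b)=a^*(b(u^{-1}\cdot a))$, where $u^{-1}\cdot a=\sum u^{-1}(a_1)a_0$. Then $F(A^* )\in{}_A\mathcal{M}^H_A$. Definition: a finite dimensional right $H$-comodule algebra $A$ is $(H,u)$-symmetric if $F(A^* )\simeq A$ in ${}_A\mathcal{M}^H_A$. *)

(* Defs.v *)
From HB Require Import structures.
From mathcomp Require Import all_boot all_order all_algebra.
From mathcomp Require Import boolp.

Set Implicit Arguments.
Unset Strict Implicit.
Unset Printing Implicit Defensive.

Import GRing.Theory.
Local Open Scope ring_scope.
Local Open Scope quotient_scope.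

Notation is_bilinear f := (bilinear_for *:%R *:%R f).

(* The tensor product V ⊗ W is the quotient of formal finite sums             *)
(* [:: (v1, w1); ...; (vn, wn)] identifying two sums when every bilinear map  *)
(* takes the same value on them. The lemmas tens_bilinear, sweedler_tens,     *)
(* sweedler_linear and tensor_linear_ext give its universal property.         *)
Section TensorProduct.
Variables (k : fieldType) (V W : lmodType k).
Implicit Types (s t : seq (V * W)).

Definition sum_val (U : lmodType k) (f : V -> W -> U) s : U :=
  \sum_(p <- s) f p.1 p.2.

Definition tensor_rel : rel (seq (V * W)) := fun s t =>
  `[< forall (U : lmodType k) (f : V -> W -> U),
        is_bilinear f -> sum_val f s = sum_val f t >].

Fact tensor_rel_refl : reflexive tensor_rel.
Proof. by move=> s; apply/asboolP. Qed.

Fact tensor_rel_sym : symmetric tensor_rel.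
Proof. by move=> s t; apply/asboolP/asboolP => st U f fb; rewrite st. Qed.

Fact tensor_rel_trans : transitive tensor_rel.
Proof.
move=> t s r /asboolP st /asboolP tr; apply/asboolP => U f fb.
by rewrite st ?tr.
Qed.

Canonical tensor_equiv :=
  EquivRel tensor_rel tensor_rel_refl tensor_rel_sym tensor_rel_trans.

Definition tensor : Type := {eq_quot tensor_equiv}.

HB.instance Definition _ := Choice.on tensor.
HB.instance Definition _ := EqQuotient.on tensor.

Let cls s : tensor := \pi_tensor s.

Fact cls_eqP s t : reflect
  (forall (U : lmodType k) (f : V -> W -> U),
     is_bilinear f -> sum_val f s = sum_val f t)
  (cls s == cls t).
Proof.
apply: (iffP idP) => [|st]; first by rewrite eqmodE /= => /asboolP.
by rewrite eqmodE /=; apply/asboolP.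
Qed.

Fact sum_val_repr (U : lmodType k) (f : V -> W -> U) s :
  is_bilinear f -> sum_val f (repr (cls s)) = sum_val f s.
Proof. by move=> fb; apply/cls_eqP: f fb; rewrite /cls reprK. Qed.

Fact sum_val_cat (U : lmodType k) (f : V -> W -> U) s t :
  sum_val f (s ++ t) = sum_val f s + sum_val f t.
Proof. by rewrite /sum_val big_cat. Qed.

Let scale_seq (a : k) s := [seq (a *: p.1, p.2) | p <- s].

Fact sum_val_scale (U : lmodType k) (f : V -> W -> U) a s :
  is_bilinear f -> sum_val f (scale_seq a s) = a *: sum_val f s.
Proof.
move=> [fl _]; rewrite /sum_val big_map scaler_sumr; apply: eq_bigr => p _ /=.
exact: (scalable_linear (fl p.2)).
Qed.

Definition tensor_add (x y : tensor) : tensor := cls (repr x ++ repr y).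
Definition tensor_scale (a : k) (x : tensor) : tensor :=
  cls (scale_seq a (repr x)).
Definition tensor_opp (x : tensor) : tensor := tensor_scale (-1) x.
Definition tensor_zero : tensor := cls [::].

Fact sum_val_add (U : lmodType k) (f : V -> W -> U) (x y : tensor) :
  is_bilinear f -> sum_val f (repr (tensor_add x y)) =
                   sum_val f (repr x) + sum_val f (repr y).
Proof. by move=> fb; rewrite sum_val_repr // sum_val_cat. Qed.

Fact sum_val_tscale (U : lmodType k) (f : V -> W -> U) a (x : tensor) :
  is_bilinear f ->
  sum_val f (repr (tensor_scale a x)) = a *: sum_val f (repr x).
Proof. by move=> fb; rewrite sum_val_repr // sum_val_scale. Qed.

Fact sum_val_zero (U : lmodType k) (f : V -> W -> U) :
  is_bilinear f -> sum_val f (repr tensor_zero) = 0.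
Proof. by move=> fb; rewrite sum_val_repr // /sum_val big_nil. Qed.

Lemma tensor_eqP (x y : tensor) :
  (forall (U : lmodType k) (f : V -> W -> U),
     is_bilinear f -> sum_val f (repr x) = sum_val f (repr y)) -> x = y.
Proof.
by move=> xy; rewrite -[x]reprK -[y]reprK; apply/eqP/cls_eqP.
Qed.

Fact tensor_addA : associative tensor_add.
Proof. by move=> x y z; apply: tensor_eqP => U f fb; rewrite !sum_val_add // addrA. Qed.
Fact tensor_addC : commutative tensor_add.
Proof. by move=> x y; apply: tensor_eqP => U f fb; rewrite !sum_val_add // addrC. Qed.
Fact tensor_add0 : left_id tensor_zero tensor_add.
Proof.
by move=> x; apply: tensor_eqP => U f fb; rewrite sum_val_add // sum_val_zero ?add0r.
Qed.
Fact tensor_addN : left_inverse tensor_zero tensor_opp tensor_add.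
Proof.
move=> x; apply: tensor_eqP => U f fb.
by rewrite sum_val_add // sum_val_zero // sum_val_tscale // scaleN1r addNr.
Qed.

HB.instance Definition _ := GRing.isZmodule.Build tensor
  tensor_addA tensor_addC tensor_add0 tensor_addN.

Fact tensor_scaleA a b x :
  tensor_scale a (tensor_scale b x) = tensor_scale (a * b) x.
Proof. by apply: tensor_eqP => U f fb; rewrite !sum_val_tscale // scalerA. Qed.
Fact tensor_scale1 : left_id 1 tensor_scale.
Proof. by move=> x; apply: tensor_eqP => U f fb; rewrite sum_val_tscale // scale1r. Qed.
Fact tensor_scaleDr : right_distributive tensor_scale +%R.
Proof.
move=> a x y; apply: tensor_eqP => U f fb.
by rewrite sum_val_tscale // !sum_val_add // !sum_val_tscale // scalerDr.
Qed.
Fact tensor_scaleDl x : {morph tensor_scale^~ x : a b / a + b}.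
Proof.
move=> a b; apply: tensor_eqP => U f fb.
by rewrite sum_val_add // !sum_val_tscale // scalerDl.
Qed.

HB.instance Definition _ := GRing.Zmodule_isLmodule.Build k tensor
  tensor_scaleA tensor_scale1 tensor_scaleDr tensor_scaleDl.

Definition tens (v : V) (w : W) : tensor := cls [:: (v, w)].

(* Sweedler sum: if t = \sum_i v_i ⊗ w_i then sweedler t f = \sum_i f v_i w_i.*)
(* It is independent of the representation of t as soon as f is bilinear,     *)
(* and is only used for such f.                                               *)
Definition sweedler (U : lmodType k) (t : tensor) (f : V -> W -> U) : U :=
  sum_val f (repr t).

Lemma sweedler_tens (U : lmodType k) (f : V -> W -> U) v w :
  is_bilinear f -> sweedler (tens v w) f = f v w.
Proof. by move=> fb; rewrite /sweedler sum_val_repr // /sum_val big_seq1. Qed.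

Lemma sweedler_linear (U : lmodType k) (f : V -> W -> U) :
  is_bilinear f -> linear (sweedler (U := U) ^~ f).
Proof.
by move=> fb a x y; rewrite /sweedler sum_val_add // sum_val_tscale.
Qed.

Lemma tens_bilinear : is_bilinear tens.
Proof.
split=> [w a v v'|v a w w'] /=; apply: tensor_eqP => U f fb;
  rewrite sum_val_add // sum_val_tscale // !sum_val_repr // /sum_val !big_seq1.
  exact: fb.1.
exact: fb.2.
Qed.

Lemma tensor_repr (t : tensor) : t = \sum_(p <- repr t) tens p.1 p.2.
Proof.
rewrite -[LHS]reprK -/(cls _); elim: (repr t) => [|p s IHs].
  by rewrite big_nil.
rewrite big_cons -IHs; apply: tensor_eqP => U f fb.
by rewrite sum_val_add // !sum_val_repr // /sum_val big_cons big_seq1.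
Qed.

Lemma tensor_linear_ext (U : lmodType k) (f g : {linear tensor -> U}) :
  (forall v w, f (tens v w) = g (tens v w)) -> f =1 g.
Proof.
move=> fg t; rewrite (tensor_repr t) !linear_sum.
by apply: eq_bigr => p _.
Qed.

End TensorProduct.

Notation "V ⊗ W" := (tensor V W)
  (at level 40, left associativity) : type_scope.
Notation "v ⊗ w" := (tens v w)
  (at level 40, left associativity) : ring_scope.
Notation "'\tsum_' ( a , b <- t ) E" := (sweedler t (fun a b => E))
  (at level 41, E at level 41, a name, b name, t at level 50,
   format "\tsum_ ( a ,  b  <-  t )  E") : ring_scope.

HB.mixin Record isHopf (k : fieldType) H of GRing.Algebra k H := {
  comul : {linear H -> (H ⊗ H)%type};
  counit : {lrmorphism H -> k^o};
  antipode : {linear H -> H};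
  comulA : forall h : H,
    \tsum_(h1, h2 <- comul h) \tsum_(x, y <- comul h1) (x ⊗ (y ⊗ h2)) =
    \tsum_(h1, h2 <- comul h) (h1 ⊗ comul h2);
  counitl : forall h : H, \tsum_(h1, h2 <- comul h) (counit h1 *: h2) = h;
  counitr : forall h : H, \tsum_(h1, h2 <- comul h) (counit h2 *: h1) = h;
  comul1 : comul 1 = 1 ⊗ 1;
  comulM : forall g h : H, comul (g * h) =
    \tsum_(g1, g2 <- comul g) \tsum_(h1, h2 <- comul h)
      ((g1 * h1) ⊗ (g2 * h2));
  antipodel : forall h : H,
    \tsum_(h1, h2 <- comul h) (antipode h1 * h2) = counit h *: 1;
  antipoder : forall h : H,
    \tsum_(h1, h2 <- comul h) (h1 * antipode h2) = counit h *: 1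
}.

#[short(type="hopfAlgType")]
HB.structure Definition HopfAlgebra (k : fieldType) :=
  {H of GRing.Algebra k H & isHopf k H}.

Section Sovereign.
Variables (k : fieldType) (H : hopfAlgType k).

Definition conv_inv (u : H -> k) (h : H) : k := u (antipode h).

Definition sovereign_character (u : {lrmorphism H -> k^o}) : Prop :=
  forall h : H, antipode (antipode h) =
    \tsum_(h1, h23 <- comul h) \tsum_(h2, h3 <- comul h23)
      ((conv_inv u h1 * u h3) *: h2).

End Sovereign.

Section Comodules.
Variables (k : fieldType) (H : hopfAlgType k).

Record comodule (M : lmodType k) (rho : M -> M ⊗ H) : Prop := {
  comodule_linear : linear rho;
  comodule_coassoc : forall m,
    \tsum_(m0, m1 <- rho m) \tsum_(x, y <- rho m0) (x ⊗ (y ⊗ m1)) =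
    \tsum_(m0, m1 <- rho m) (m0 ⊗ comul m1);
  comodule_counit : forall m,
    \tsum_(m0, m1 <- rho m) (counit m1 *: m0) = m
}.

Definition dual_act (M : lmodType k) (rho : M -> M ⊗ H) (f : H -> k) (m : M)
    : M :=
  \tsum_(m0, m1 <- rho m) (f m1 *: m0).

(* Finite dimensional spaces with a product, a unit and a map to _ ⊗ H; the   *)
(* axioms are in is_comodule_algebra. The product is not taken from algType,  *)
(* which excludes the zero algebra.                                           *)
Structure comodAlgData := ComodAlgData {
  ca_sort :> vectType k;
  ca_mul : ca_sort -> ca_sort -> ca_sort;
  ca_one : ca_sort;
  ca_coact : ca_sort -> ca_sort ⊗ H
}.

Record is_comodule_algebra (A : comodAlgData) : Prop := {
  ca_mul_bilinear : is_bilinear (@ca_mul A);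
  ca_mulA : associative (@ca_mul A);
  ca_mul1l : left_id (@ca_one A) (@ca_mul A);
  ca_mul1r : right_id (@ca_one A) (@ca_mul A);
  ca_comodule : comodule (@ca_coact A);
  ca_coact1 : ca_coact (@ca_one A) = ca_one A ⊗ 1;
  ca_coactM : forall a b : A, ca_coact (ca_mul a b) =
    \tsum_(a0, a1 <- ca_coact a) \tsum_(b0, b1 <- ca_coact b)
      (ca_mul a0 b0 ⊗ (a1 * b1))
}.

(* A finite dimensional space with left and right operations of A and a map   *)
(* to _ ⊗ H: the data of an object of the category of A,A-bimodules in M^H.   *)
Structure bicomodData (A : comodAlgData) := BicomodData {
  bc_sort :> vectType k;
  bc_lact : A -> bc_sort -> bc_sort;
  bc_ract : bc_sort -> A -> bc_sort;
  bc_coact : bc_sort -> bc_sort ⊗ H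
}.

Definition regular_bicomod (A : comodAlgData) : bicomodData A :=
  @BicomodData A A (@ca_mul A) (@ca_mul A) (@ca_coact A).

Record bicomod_morphism (A : comodAlgData) (M N : bicomodData A) (f : M -> N)
    : Prop := {
  bm_linear : linear f;
  bm_lact : forall (a : A) (m : M), f (bc_lact a m) = bc_lact a (f m);
  bm_ract : forall (m : M) (a : A), f (bc_ract m a) = bc_ract (f m) a;
  bm_coact : forall m : M,
    bc_coact (f m) = \tsum_(m0, m1 <- bc_coact m) (f m0 ⊗ m1)
}.

Definition bicomod_iso (A : comodAlgData) (M N : bicomodData A) : Prop :=
  exists (f : M -> N) (g : N -> M),
    [/\ bicomod_morphism f, bicomod_morphism g, cancel f g & cancel g f].

Definition dual (A : comodAlgData) : vectType k := 'Hom(A, k^o).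

(* dual_coact f = \sum_i e_i^* ⊗ \sum f(e_i0) S(e_i1) for a basis (e_i) of A; *)
(* dual_coactP and dual_coact_uniq show that it is characterised by           *)
(* \sum f_0(a) f_1 = \sum f(a_0) S(a_1), hence independent of the basis.      *)
Definition dual_coact (A : comodAlgData) (f : dual A) : dual A ⊗ H :=
  \sum_(i < \dim {:A})
    linfun (coord (vbasis {:A}) i : A -> k^o) ⊗
      (\tsum_(a0, a1 <- ca_coact (vbasis {:A})`_i) ((f a0 : k) *: antipode a1)).

Fact eval_bilinear (A : comodAlgData) (a : A) :
  is_bilinear (fun (f : dual A) (h : H) => (f a : k) *: h).
Proof.
split=> [h c f g|f c g h] /=.
  by rewrite add_lfunE scale_lfunE scalerDl scalerA.
by rewrite scalerDr !scalerA mulrC.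
Qed.

Fact coeff_bilinear (A : comodAlgData) (f : dual A) (g : {linear H -> H}) :
  is_bilinear (fun (a : A) (h : H) => (f a : k) *: g h).
Proof.
split=> [h c a b|a c g' h] /=.
  by rewrite linearP /= scalerDl scalerA.
by rewrite linearP /= scalerDr !scalerA mulrC.
Qed.

Lemma dual_coactP (A : comodAlgData) (f : dual A) (a : A) :
  linear (@ca_coact A) ->
  \tsum_(f0, f1 <- dual_coact f) ((f0 a : k) *: f1) =
  \tsum_(a0, a1 <- ca_coact a) ((f a0 : k) *: antipode a1).
Proof.
move=> rho_lin.
pose rho := GRing.isLinear.Build k A (A ⊗ H)%type *:%R (@ca_coact A) rho_lin.
pose rhoL : {linear A -> (A ⊗ H)%type} := HB.pack (@ca_coact A) rho.
pose ev := GRing.isLinear.Build k (dual A ⊗ H)%type H *:%R _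
  (sweedler_linear (eval_bilinear a)).
pose evf (t : dual A ⊗ H) : H := \tsum_(f0, f1 <- t) ((f0 a : k) *: f1).
pose evL : {linear (dual A ⊗ H)%type -> H} := HB.pack evf ev.
pose co := GRing.isLinear.Build k (A ⊗ H)%type H *:%R _
  (sweedler_linear (coeff_bilinear f (@antipode k H))).
pose cof (t : A ⊗ H) : H := \tsum_(a0, a1 <- t) ((f a0 : k) *: antipode a1).
pose coL : {linear (A ⊗ H)%type -> H} := HB.pack cof co.
rewrite -[LHS]/(evL _) -[RHS]/(coL (rhoL a)).
rewrite [in RHS](coord_vbasis (memvf a)) !linear_sum.
apply: eq_bigr => i _; rewrite !linearZ.
rewrite -[LHS]/(evf _) /evf sweedler_tens; last exact: eval_bilinear.
by rewrite lfunE.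
Qed.

Lemma dual_coact_uniq (A : comodAlgData) (s t : dual A ⊗ H) :
  (forall a : A, \tsum_(f0, f1 <- s) ((f0 a : k) *: f1) =
                 \tsum_(f0, f1 <- t) ((f0 a : k) *: f1)) -> s = t.
Proof.
move=> st.
pose e i : dual A := linfun (coord (vbasis {:A}) i : A -> k^o).
suff tE (x : dual A ⊗ H) : x = \sum_(i < \dim {:A}) e i ⊗
    (\tsum_(f0, f1 <- x) ((f0 (vbasis {:A})`_i : k) *: f1)).
  by rewrite (tE s) (tE t); apply: eq_bigr => i _; rewrite st.
rewrite [LHS]tensor_repr.
pose tl h := GRing.isLinear.Build k (dual A) (dual A ⊗ H)%type *:%R _
  ((@tens_bilinear k (dual A) H).1 h).
pose tlL h : {linear dual A -> (dual A ⊗ H)%type} :=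
  HB.pack (fun f : dual A => f ⊗ h) (tl h).
pose tr f := GRing.isLinear.Build k H (dual A ⊗ H)%type *:%R _
  ((@tens_bilinear k (dual A) H).2 f).
pose trL f : {linear H -> (dual A ⊗ H)%type} :=
  HB.pack (fun h : H => f ⊗ h) (tr f).
transitivity (\sum_(i < \dim {:A}) \sum_(p <- repr x)
    e i ⊗ ((p.1 (vbasis {:A})`_i : k) *: p.2)); last first.
  apply: eq_bigr => i _; rewrite /sweedler /sum_val.
  by rewrite -[RHS]/(trL (e i) _) linear_sum.
rewrite exchange_big; apply: eq_bigr => -[f h] _ /=.
have fE : f = \sum_(i < \dim {:A}) (f (vbasis {:A})`_i : k) *: e i.
  apply/lfunP => a; rewrite sum_lfunE [in LHS](coord_vbasis (memvf a)).
  rewrite linear_sum; apply: eq_bigr => i _.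
  by rewrite linearZ scale_lfunE lfunE /= /GRing.scale /= mulrC.
rewrite {1}fE -[LHS]/(tlL h _) linear_sum; apply: eq_bigr => i _.
by rewrite linearZ -[RHS]/(trL (e i) _) linearZ.
Qed.

Definition dual_lact (A : comodAlgData) (u : H -> k) (a : A) (f : dual A)
    : dual A :=
  linfun (fun b : A =>
    f (ca_mul b (dual_act (@ca_coact A) (conv_inv u) a)) : k^o).

Definition dual_ract (A : comodAlgData) (f : dual A) (a : A) : dual A :=
  linfun (fun b : A => f (ca_mul a b) : k^o).

Definition dual_bicomod (u : H -> k) (A : comodAlgData) : bicomodData A :=
  @BicomodData A (dual A) (@dual_lact A u) (@dual_ract A) (@dual_coact A).

Definition symmetric_comodule_algebra (u : H -> k) (A : comodAlgData) : Prop :=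
  bicomod_iso (dual_bicomod u A) (regular_bicomod A).

Definition trivial_extension (A : comodAlgData) (M : bicomodData A)
    : comodAlgData :=
  @ComodAlgData (A * M)%type
    (fun x y => (ca_mul x.1 y.1, bc_lact x.1 y.2 + bc_ract x.2 y.1))
    (ca_one A, 0)
    (fun x => \tsum_(a0, a1 <- ca_coact x.1) ((a0, 0) ⊗ a1) +
              \tsum_(m0, m1 <- bc_coact x.2) ((0, m0) ⊗ m1)).

End Comodules.

(* Main.v *)
(* The linear form lam (a, f) = f 1 on the trivial extension E makes it        *)
(* symmetric: lam is colinear and satisfies lam (x y) = lam (y (u^-1 . x)), so *)
(* x |-> lam (x -) is a morphism E -> F(E^* ) in the bimodule category, and it *)
(* is injective because a |-> u^-1 . a is invertible, hence bijective by       *)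
(* dimension. That F(A^* ) is a bimodule in M^H rests on the identity          *)
(* \sum u^-1(h2) h3 S(h1) = u^-1(h) 1, a form of sovereignty.                  *)

(* Symmetry of a comodule algebra follows from a Frobenius form ([symmetric_of_form]): a linear form
   [lam] that is colinear, nondegenerate, and symmetric up to the twist x -> u^-1 . x. On the
   trivial extension, lam(a, f) = f(1) gives lam((a, f)(b, g)) = g(u^-1 . a) + f(b); the first term
   comes from the twist built into the left action of F(A^* ). Twisted symmetry then reduces to
   (u^-1 . f)(u^-1 . b) = f(b), which is [dual_act_pairing], and nondegeneracy to the injectivity of
   a -> u^-1 . a, which is [dual_act_conv_invK].

   That the trivial extension is a comodule algebra is formal once F(A^* ) is a bimodule in
   comodules ([dual_bicomod_is_bicomodule]). The delicate axiom is colinearity of the left action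
   ([dual_coactl]): there the expression u^-1(a_2) a_3 S(a_1) appears, with the antipode on the
   wrong side for a direct cancellation, and sovereignty collapses it to u^-1(a_1)
   ([conv_inv_antipode]). Identities in A^* ⊗ W are checked by evaluating the first factor at
   elements of A ([hom_tensor_eq]). *)
From HB Require Import structures.
Require Import Defs.
From mathcomp Require Import all_boot all_order all_algebra.

Set Implicit Arguments.
Unset Strict Implicit.
Unset Printing Implicit Defensive.

Import GRing.Theory.
Local Open Scope ring_scope.

(* A constant, as opposed to the notation [linear], so that the tactic [lin]   *)
(* below can match on it.                                                     *)
Definition islin (k : fieldType) (V W : lmodType k) (f : V -> W) : Prop :=
  linear f.

(** * Closure properties of linear maps *)

Section Linear.
Variables (k : fieldType) (U V W X : lmodType k).

Lemma islin_can (f : {linear V -> W}) : islin f.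
Proof. exact: linearP. Qed.

Lemma islin_id : islin (fun x : V => x).
Proof. by []. Qed.

Lemma islin_comp (g : V -> W) (f : U -> V) :
  islin g -> islin f -> islin (fun x => g (f x)).
Proof. by move=> gl fl a x y; rewrite fl gl. Qed.

Lemma islin_add (f g : V -> W) :
  islin f -> islin g -> islin (fun x => f x + g x).
Proof. by move=> fl gl a x y; rewrite fl gl scalerDr addrACA. Qed.

Lemma islin_bil1 (b : V -> W -> X) (f : U -> V) w :
  is_bilinear b -> islin f -> islin (fun x => b (f x) w).
Proof. by move=> [bl _] fl a x y /=; rewrite fl (bl w). Qed.

Lemma islin_bil2 (b : V -> W -> X) (f : U -> W) v :
  is_bilinear b -> islin f -> islin (fun x => b v (f x)).
Proof. by move=> [_ bl] fl a x y /=; rewrite fl (bl v). Qed.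

Lemma bilinear_islin (b : V -> W -> X) :
  (forall w, islin (fun v => b v w)) -> (forall v, islin (fun w => b v w)) ->
  is_bilinear b.
Proof. by move=> bl br; split=> [w|v]; [apply: bl|apply: br]. Qed.

Lemma islin_scale1 (f : V -> k^o) (w : W) :
  islin f -> islin (fun x => (f x : k) *: w).
Proof. by move=> fl a x y; rewrite fl scalerDl scalerA. Qed.

Lemma islin_scale2 (a : k) (f : V -> W) :
  islin f -> islin (fun x => a *: f x).
Proof. by move=> fl b x y; rewrite fl scalerDr !scalerA mulrC. Qed.

Lemma islinZ (f : V -> W) a x : islin f -> f (a *: x) = a *: f x.
Proof. by move=> fl; exact: (scalable_linear fl). Qed.

Lemma islinD (f : V -> W) x y : islin f -> f (x + y) = f x + f y.
Proof. by move=> fl; have := fl 1 x y; rewrite !scale1r. Qed.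

Lemma islin0 (f : V -> W) : islin f -> f 0 = 0.
Proof. by move=> fl; rewrite -(scale0r 0) (islinZ _ _ fl) scale0r. Qed.

Lemma islin_sum (f : V -> W) I (r : seq I) (E : I -> V) :
  islin f -> f (\sum_(i <- r) E i) = \sum_(i <- r) f (E i).
Proof.
move=> fl; elim: r => [|i r IHr]; first by rewrite !big_nil islin0.
by rewrite !big_cons (islinD _ _ fl) IHr.
Qed.

End Linear.

Section AlgLinear.
Variables (k : fieldType) (H : algType k) (V W : lmodType k).

Lemma islin_mul1 (f : V -> H) c : islin f -> islin (fun x => f x * c).
Proof. by move=> fl a x y; rewrite fl mulrDl scalerAl. Qed.

Lemma islin_mul2 (f : V -> H) c : islin f -> islin (fun x => c * f x).
Proof. by move=> fl a x y; rewrite fl mulrDr scalerAr. Qed.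
End AlgLinear.

Section VectLinear.
Variables (k : fieldType) (U : lmodType k) (V W : vectType k).

Lemma islin_hom (h : 'Hom(V, W)) : islin (fun v => h v).
Proof. exact: linearP. Qed.

Lemma islin_eval (F : U -> 'Hom(V, W)) v :
  islin F -> islin (fun x => F x v).
Proof. by move=> Fl a x y; rewrite Fl add_lfunE scale_lfunE. Qed.

Lemma islin_pair (f : U -> V) (g : U -> W) :
  islin f -> islin g -> islin (fun x => (f x, g x) : (V * W)%type).
Proof. by move=> fl gl a x y; rewrite fl gl. Qed.
Lemma islin_cst0 : islin (fun _ : U => 0 : V).
Proof. by move=> a x y; rewrite scaler0 addr0. Qed.
Lemma islin_fst (f : U -> (V * W)%type) : islin f -> islin (fun x => (f x).1).
Proof. by move=> fl a x y; rewrite fl. Qed.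
Lemma islin_snd (f : U -> (V * W)%type) : islin f -> islin (fun x => (f x).2).
Proof. by move=> fl a x y; rewrite fl. Qed.
End VectLinear.

(** * Calculus of Sweedler sums *)

Section Sweedler.
Variables (k : fieldType) (T U V W X : lmodType k).

(** A Sweedler sum is a finite sum over a chosen representative of [t], so rules that keep [t] hold
    for arbitrary summands. Bilinearity enters in [tsum_tensE] and [tsum_tsum], where the
    representative changes. *)
Lemma eq_tsum (f g : V -> W -> U) t :
  (forall v w, f v w = g v w) -> sweedler t f = sweedler t g.
Proof. by move=> fg; apply: eq_bigr => p _; apply: fg. Qed.

Lemma islin_tsum (f : T -> V -> W -> U) t :
  (forall v w, islin (fun x => f x v w)) ->
  islin (fun x => sweedler t (f x)).
Proof.
move=> fl a x y; rewrite /sweedler /sum_val scaler_sumr -big_split.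
by apply: eq_bigr => p _; rewrite fl.
Qed.

Lemma islin_tsum_comp (t : T -> V ⊗ W) (f : V -> W -> U) :
  islin t -> (forall w, islin (fun v => f v w)) ->
  (forall v, islin (fun w => f v w)) ->
  islin (fun x => sweedler (t x) f).
Proof.
move=> tl fl fr; apply: (islin_comp (sweedler_linear _) tl).
exact: bilinear_islin.
Qed.

Lemma tsum_tensE (f : V -> W -> U) v w :
  (forall w, islin (fun v => f v w)) -> (forall v, islin (fun w => f v w)) ->
  sweedler (v ⊗ w) f = f v w.
Proof. by move=> fl fr; rewrite sweedler_tens //; exact: bilinear_islin. Qed.

Lemma lin_tsum (g : U -> X) (f : V -> W -> U) t :
  islin g -> g (sweedler t f) = sweedler t (fun v w => g (f v w)).
Proof. by move=> gl; rewrite /sweedler /sum_val islin_sum. Qed.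

Lemma scale_tsum (a : k) (f : V -> W -> U) t :
  a *: sweedler t f = sweedler t (fun v w => a *: f v w).
Proof. by rewrite /sweedler /sum_val scaler_sumr. Qed.

Lemma tsum_exch (V' W' : lmodType k) (f : V -> W -> V' -> W' -> U) s t :
  sweedler s (fun v w => sweedler t (f v w)) =
  sweedler t (fun v' w' => sweedler s (fun v w => f v w v' w')).
Proof. by rewrite /sweedler /sum_val exchange_big. Qed.

Lemma tsum_ext (t : V ⊗ W) : sweedler t (@tens k V W) = t.
Proof. by rewrite [RHS]tensor_repr. Qed.

Lemma tsum0 (t : V ⊗ W) : sweedler t (fun _ _ => 0 : U) = 0.
Proof. by rewrite /sweedler /sum_val big1. Qed.

Lemma tsum_addE (f g : V -> W -> U) t :
  sweedler t (fun v w => f v w + g v w) = sweedler t f + sweedler t g.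
Proof. by rewrite /sweedler /sum_val big_split. Qed.
End Sweedler.

Lemma tsum_tsum (k : fieldType) (U V W V' W' : lmodType k)
    (g : V' -> W' -> V ⊗ W) (f : V -> W -> U) t :
  (forall w, islin (fun v => f v w)) -> (forall v, islin (fun w => f v w)) ->
  sweedler (sweedler t g) f = sweedler t (fun v' w' => sweedler (g v' w') f).
Proof.
move=> fl fr; rewrite (lin_tsum (g := sweedler (U := U) ^~ f)) //.
by apply: sweedler_linear; exact: bilinear_islin.
Qed.

Lemma tsum_mull (k : fieldType) (H : algType k) (V W : lmodType k) (c : H)
    (f : V -> W -> H) t :
  sweedler t f * c = sweedler t (fun v w => f v w * c).
Proof. by rewrite /sweedler /sum_val mulr_suml. Qed.

(* Proves linearity of an expression in which the variable occurs exactly     *)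
(* once in every summand, by descending to that occurrence.                   *)
Ltac lin1 :=
  lazymatch goal with
  | |- forall _, _ => intro; cbv beta
  | |- bilinear_for _ _ _ => apply: bilinear_islin
  | |- islin _ => first
    [ solve [auto]
    | exact: islin_id
    | exact: islin_can
    | exact: islin_hom
    | lazymatch goal with
      | |- islin (fun _ => _) => idtac
      | |- islin ?f => change (islin (fun x => f x))
      end; lin_comp ]
  end
with lin_comp :=
  match goal with
  | |- islin (fun x => @?f x + @?g x) => apply: islin_add
  | |- islin (fun x => (@?f x, @?g x)) => apply: islin_pair
  | |- islin (fun x => (@?f x).1) => apply: islin_fst
  | |- islin (fun x => (@?f x).2) => apply: islin_snd
  | |- islin (fun x => 0) => apply: islin_cst0
  | |- islin (fun x => sweedler ?t (@?f x)) => apply: islin_tsum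
  | |- islin (fun x => sweedler (@?t x) ?f) => apply: islin_tsum_comp
  | |- islin (fun x => @?f x ⊗ ?c) => apply: (islin_bil1 _ (@tens_bilinear _ _ _))
  | |- islin (fun x => ?c ⊗ @?f x) => apply: (islin_bil2 _ (@tens_bilinear _ _ _))
  | |- islin (fun x => @?f x * ?c) => apply: islin_mul1
  | |- islin (fun x => ?c * @?f x) => apply: islin_mul2
  | |- islin (fun x => @?f x *: ?c) => apply: islin_scale1
  | |- islin (fun x => ?c *: @?f x) => apply: islin_scale2
  | |- islin (fun x => fun_of_lfun (@?f x) ?c) => apply: islin_eval
  | |- islin (fun x => fun_of_lfun ?c (@?f x)) => apply: (islin_comp (islin_hom c))
  | Hb : bilinear_for _ _ ?b |- islin (fun x => ?b (@?f x) ?c) => apply: (islin_bil1 _ Hb)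
  | Hb : bilinear_for _ _ ?b |- islin (fun x => ?b ?c (@?f x)) => apply: (islin_bil2 _ Hb)
  | |- islin (fun x => ?g (@?f x)) =>
    apply: (@islin_comp _ _ _ _ g f); [solve [auto | exact: islin_can]|]
  | Hg : islin ?g |- islin (fun x => ?g' (@?f x)) =>
    unify g g'; apply: (islin_comp (f := f) Hg)
  | |- islin (fun x => ?g (@?f x) ?b) =>
    apply: (@islin_comp _ _ _ _ (fun y => g y b) f); [solve [auto]|]
  | |- islin (fun x => ?g (@?f x) ?b ?c) =>
    apply: (@islin_comp _ _ _ _ (fun y => g y b c) f); [solve [auto]|]
  end.
Ltac lin := cbv beta; repeat lin1.

(** * Coassociativity and counit under multilinear expressions *)

Section Comodule.
Variables (k : fieldType) (H : hopfAlgType k) (M U : lmodType k).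
Variable rho : M -> M ⊗ H.
Hypothesis rhoP : comodule rho.

(** A trilinear [F] induces a linear map [ev] on [M ⊗ (H ⊗ H)]; applying it to the coassociativity
    axiom gives a rule usable inside any Sweedler sum. *)
Lemma comod_coassocE (F : M -> H -> H -> U) m :
  (forall y z, islin (fun x => F x y z)) -> (forall x z, islin (fun y => F x y z)) ->
  (forall x y, islin (fun z => F x y z)) ->
  \tsum_(m0, m1 <- rho m) \tsum_(x, y <- rho m0) F x y m1 =
  \tsum_(m0, m1 <- rho m) \tsum_(x, y <- comul m1) F m0 x y.
Proof.
move=> F1 F2 F3.
pose ev (t : M ⊗ (H ⊗ H)%type) := \tsum_(x, p <- t) \tsum_(y, z <- p) F x y z.
have evl : islin ev by rewrite /ev; lin.
have := congr1 ev (comodule_coassoc rhoP m).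
rewrite !(lin_tsum _ _ evl) => E; transitivity (\tsum_(m0, m1 <- rho m)
  ev (\tsum_(x, y <- rho m0) (x ⊗ (y ⊗ m1)))).
  apply: eq_tsum => v w; rewrite (lin_tsum _ _ evl); apply: eq_tsum => x y.
  by rewrite /ev tsum_tensE; first rewrite tsum_tensE; lin.
rewrite {}E; apply: eq_tsum => v w.
by rewrite /ev tsum_tensE; lin.
Qed.

Lemma comod_counitE (F : M -> U) m : islin F ->
  \tsum_(m0, m1 <- rho m) ((counit m1 : k) *: F m0) = F m.
Proof.
move=> Fl; rewrite -[in RHS](comodule_counit rhoP m) (lin_tsum _ _ Fl).
by apply: eq_tsum => v w; rewrite (islinZ _ _ Fl).
Qed.
End Comodule.

(** * The antipode, characters and sovereignty *)

Section Hopf.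
Variables (k : fieldType) (H : hopfAlgType k).
Implicit Types (g h : H).

(** Makes the comodule rules available for [comul] as well. *)
Lemma comul_comodule : comodule (@comul k H).
Proof. by split; [exact: linearP | exact: comulA | exact: counitr]. Qed.

Section Rules.
Variable (U : lmodType k).

Lemma counitlE (F : H -> U) h : islin F ->
  \tsum_(h1, h2 <- comul h) ((counit h1 : k) *: F h2) = F h.
Proof.
move=> Fl; rewrite -[in RHS](counitl h) (lin_tsum _ _ Fl).
by apply: eq_tsum => v w; rewrite (islinZ _ _ Fl).
Qed.

Definition counitrE := comod_counitE (U := U) comul_comodule.
Definition coassocE := comod_coassocE (U := U) comul_comodule.

Lemma antipodelE (F : H -> U) h : islin F ->
  \tsum_(h1, h2 <- comul h) F (antipode h1 * h2) = (counit h : k) *: F 1.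
Proof. by move=> Fl; rewrite -(lin_tsum _ _ Fl) antipodel (islinZ _ _ Fl). Qed.

Lemma antipoderE (F : H -> U) h : islin F ->
  \tsum_(h1, h2 <- comul h) F (h1 * antipode h2) = (counit h : k) *: F 1.
Proof. by move=> Fl; rewrite -(lin_tsum _ _ Fl) antipoder (islinZ _ _ Fl). Qed.

Lemma comulME (F : H -> H -> U) g h :
  (forall y, islin (fun x => F x y)) -> (forall x, islin (fun y => F x y)) ->
  \tsum_(x, y <- comul (g * h)) F x y =
  \tsum_(g1, g2 <- comul g) \tsum_(h1, h2 <- comul h) F (g1 * h1) (g2 * h2).
Proof.
move=> Fl Fr; rewrite comulM tsum_tsum //; apply: eq_tsum => g1 g2.
by rewrite tsum_tsum //; apply: eq_tsum => h1 h2; rewrite tsum_tensE.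
Qed.
End Rules.

Lemma antipode1 : antipode (1 : H) = 1.
Proof.
have := antipodel (1 : H); rewrite comul1 tsum_tensE; [|lin|lin].
by rewrite mulr1 rmorph1 scale1r.
Qed.

(** Applying the counit to \sum S(h1) h2 = counit(h) 1 gives \sum counit(S(h1)) counit(h2) =
    counit(h), and the left side is counit(S(h)) by the counit axiom. *)
Lemma counit_antipode h : counit (antipode h) = counit h.
Proof.
have cl : islin (@counit k H) by exact: linearP.
have := congr1 (@counit k H) (antipodel h).
rewrite (lin_tsum _ _ cl) (islinZ _ _ cl) rmorph1 => E.
rewrite -[RHS]mulr1 -[RHS]E -[in LHS](counitr h).
rewrite (lin_tsum (g := fun x => counit (antipode x))); last by lin.
by apply: eq_tsum => x y; rewrite !linearZ /= rmorphM mulrC.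
Qed.

(* The two sides are the two ways to evaluate                                 *)
(* \sum S(h1) S(g1) (g2 h2) S(g3 h3).                                         *)
Lemma antipodeM g h : antipode (g * h) = antipode h * antipode g.
Proof.
pose X a b c d z : H := antipode c * antipode a * (b * d * antipode z).
transitivity (\tsum_(g1, g2 <- comul g) \tsum_(a, b <- comul g1)
  \tsum_(h1, h2 <- comul h) \tsum_(c, d <- comul h1) X a b c d (g2 * h2)).
  transitivity (\tsum_(g1, g2 <- comul g) \tsum_(a, b <- comul g1)
      \tsum_(h1, h2 <- comul h) \tsum_(c, d <- comul h1)
      (antipode c * (antipode a * b) * d * antipode (g2 * h2))).
    (* The inner pair [antipode a * b] collapses before [antipode c * d]; the two counits left over
       turn [g2 * h2] into [g * h]. *)
    under [RHS]eq_tsum => g1 g2.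
      rewrite (antipodelE (F := fun x => \tsum_(h1, h2 <- comul h)
        \tsum_(c, d <- comul h1) (antipode c * x * d * antipode (g2 * h2))));
        last by lin.
      under eq_tsum => h1 h2.
        under eq_tsum => c d do rewrite mulr1.
        rewrite (antipodelE (F := fun x => x * antipode (g2 * h2))); last by lin.
        rewrite mul1r.
      over.
      rewrite (counitlE (F := fun x => antipode (g2 * x))); last by lin.
    over.
    by rewrite (counitlE (F := fun x => antipode (x * h))); last by lin.
  by do 4!apply: eq_tsum => ? ?; rewrite /X !mulrA.
(* For the other evaluation, (g2 h2) S(g3 h3) is \sum x S(y) over the coproduct of a product, so it
   collapses and S(h) S(g) remains. *)
rewrite /X coassocE; [|lin..].
under eq_tsum => g1 g2.
  under eq_tsum => a b do (rewrite coassocE; [|lin..]).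
  rewrite tsum_exch.
  under eq_tsum => h1 h2.
    rewrite -(comulME (F := fun x y => antipode h1 * antipode g1 * (x * antipode y)));
      [|lin..].
    rewrite (antipoderE (F := fun x => antipode h1 * antipode g1 * x)); last by lin.
    rewrite mulr1 rmorphM /= -scalerA.
  over.
  rewrite -scale_tsum.
  rewrite (counitrE (F := fun x => antipode x * antipode g1)); last by lin.
over.
by rewrite (counitrE (F := fun x => antipode h * antipode x)); last by lin.
Qed.

(* The two sides are the two ways to evaluate                                 *)
(* \sum (S(h2) ⊗ S(h1)) \Delta(h3) \Delta(S(h4)).                             *)
Lemma comul_antipode h : comul (antipode h) =
  \tsum_(h1, h2 <- comul h) (antipode h2 ⊗ antipode h1).
Proof.
pose X p1 p2 x y q := \tsum_(z, w <- comul (antipode q))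
  ((antipode p2 * x * z) ⊗ (antipode p1 * y * w) : H ⊗ H).
transitivity (\tsum_(p, q <- comul h) \tsum_(q1, q2 <- comul q)
  \tsum_(p1, p2 <- comul p) \tsum_(x, y <- comul q1) X p1 p2 x y q2).
  rewrite -coassocE; rewrite /X; [|lin..].
  (* With four legs r1, ..., r4 the cancellation goes from the inside out: S(r2) r3 in the first
     tensor factor, then S(r1) r4 in the second. *)
  have E r q : \tsum_(p, q1 <- comul r) \tsum_(p1, p2 <- comul p)
      \tsum_(x, y <- comul q1) X p1 p2 x y q =
      (counit r : k) *: comul (antipode q).
    rewrite /X coassocE; [|lin..].
    under eq_tsum => p1 s.
      rewrite -(coassocE (F := fun a b c => \tsum_(z, w <- comul (antipode q))
       ((antipode a * b * z) ⊗ (antipode p1 * c * w)))); [|lin..].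
      under eq_tsum => t y.
        rewrite (antipodelE (F := fun c => \tsum_(z, w <- comul (antipode q))
          ((c * z) ⊗ (antipode p1 * y * w)))); last by lin.
      over.
      rewrite (counitlE (F := fun y => \tsum_(z, w <- comul (antipode q))
          ((1 * z) ⊗ (antipode p1 * y * w)))); last by lin.
    over.
    rewrite (antipodelE (F := fun c => \tsum_(z, w <- comul (antipode q))
          ((1 * z) ⊗ (c * w)))); last by lin.
    by under eq_tsum => z w do rewrite !mul1r; rewrite tsum_ext.
  under [RHS]eq_tsum => r q do rewrite E.
  by rewrite (counitlE (F := fun x => comul (antipode x))); last by lin.
(* Here the coproducts of [q1] and of [antipode q2] multiply to that of [q1 * antipode q2], which
   reduces to the counit times [1 ⊗ 1]. *)
under eq_tsum => p q.
  under eq_tsum => q1 q2.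
    under eq_tsum => p1 p2.
      rewrite /X; under eq_tsum => x y do
        (under eq_tsum => z w do rewrite -!mulrA).
      rewrite -(comulME (F := fun x y => (antipode p2 * x) ⊗ (antipode p1 * y)));
        [|lin..].
    over.
  over.
  rewrite (antipoderE (F := fun x => \tsum_(p1, p2 <- comul p)
     \tsum_(a, b <- comul x) ((antipode p2 * a) ⊗ (antipode p1 * b))));
     last by lin.
  rewrite comul1.
  under eq_tsum => p1 p2 do (rewrite tsum_tensE; [rewrite !mulr1|lin..]).
over.
by rewrite (counitrE (F := fun p => \tsum_(p1, p2 <- comul p)
  (antipode p2 ⊗ antipode p1))); last by lin.
Qed.

(** A character composed with the antipode is its convolution inverse: push the antipode axiom
    through [chi]. The scalars act on a vector [v] because that is how they occur in Sweedler
    sums. *)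
Lemma character_antipodel (chi : H -> k^o) (U : lmodType k) (v : U) h :
    islin chi -> chi 1 = 1 -> {morph chi : x y / x * y} ->
  \tsum_(h1, h2 <- comul h) ((chi (antipode h1) : k) *: ((chi h2 : k) *: v)) =
  (counit h : k) *: v.
Proof.
move=> chil chi1 chiM.
under eq_tsum => x y do rewrite scalerA -[_ * _]chiM.
rewrite (antipodelE (F := fun x => (chi x : k) *: v)); last by lin.
by rewrite chi1 scale1r.
Qed.

Lemma character_antipoder (chi : H -> k^o) (U : lmodType k) (v : U) h :
    islin chi -> chi 1 = 1 -> {morph chi : x y / x * y} ->
  \tsum_(h1, h2 <- comul h) ((chi h1 : k) *: ((chi (antipode h2) : k) *: v)) =
  (counit h : k) *: v.
Proof.
move=> chil chi1 chiM.
under eq_tsum => x y do rewrite scalerA -[_ * _]chiM.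
rewrite (antipoderE (F := fun x => (chi x : k) *: v)); last by lin.
by rewrite chi1 scale1r.
Qed.

Variable u : {lrmorphism H -> k^o}.
Notation uinv := (conv_inv u).

Lemma conv_inv_lin : islin (uinv : H -> k^o).
Proof. by rewrite /conv_inv; lin. Qed.

Lemma conv_inv1 : uinv 1 = 1.
Proof. by rewrite /conv_inv antipode1 rmorph1. Qed.

Lemma conv_invM : {morph uinv : x y / x * y}.
Proof. by move=> x y; rewrite /conv_inv antipodeM rmorphM mulrC. Qed.

Hypothesis uS : sovereign_character u.
Let uinvl := conv_inv_lin.

(** Sovereignty says S^2 = u^-1 * id * u for convolution; convolving with u^-1 on the right cancels
    u. *)
Lemma sovereign_antipode2 (U : lmodType k) (F : H -> U) h : islin F ->
  \tsum_(h1, h2 <- comul h) (uinv h2 *: F (antipode (antipode h1))) =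
  \tsum_(h1, h2 <- comul h) (uinv h1 *: F h2).
Proof.
move=> Fl.
under eq_tsum => h1 h2.
  rewrite uS (lin_tsum (g := fun x => uinv h2 *: F x)); last by lin.
  under eq_tsum => a q.
    rewrite (lin_tsum (g := fun x => uinv h2 *: F x)); last by lin.
    under eq_tsum => b c do rewrite (islinZ _ _ Fl) -scalerA.
  over.
over.
rewrite /= (coassocE (F := fun a q r => \tsum_(b, c <- comul q)
  (uinv r *: (uinv a *: ((u c : k) *: F b))))); [|lin..].
apply: eq_tsum => a s.
rewrite coassocE; [|lin..].
rewrite -[RHS](counitrE (F := fun b => uinv a *: F b)); last by lin.
apply: eq_tsum => b t.
rewrite -(character_antipoder (chi := u)); [|lin|exact: rmorph1|exact: rmorphM].
apply: eq_tsum => c r; rewrite !scalerA; congr (_ *: _).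
by rewrite mulrC mulrA.
Qed.

(** By [sovereign_antipode2], \sum u^-1(h2) h3 S(h1) = \sum u^-1(h3) S^2(h2) S(h1) = \sum u^-1(h3)
    S(h1 S(h2)), and the argument of the outer S collapses. *)
Lemma conv_inv_antipode (U : lmodType k) (F : H -> U) h : islin F ->
  \tsum_(h1, h2 <- comul h) \tsum_(x, y <- comul h2)
    (uinv x *: F (y * antipode h1)) = uinv h *: F 1.
Proof.
move=> Fl.
under eq_tsum => p q.
  rewrite -(sovereign_antipode2 (F := fun y => F (y * antipode p))); last by lin.
  under eq_tsum => x y do rewrite -antipodeM.
over.
rewrite -(coassocE (F := fun p x y => uinv y *: F (antipode (p * antipode x))));
  [|lin..].
under eq_tsum => t y.
  rewrite (antipoderE (F := fun x => uinv y *: F (antipode x))); last by lin.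
  rewrite antipode1.
over.
by rewrite (counitlE (F := fun y => uinv y *: F 1)); last by lin.
Qed.
End Hopf.

(** * Bimodules in comodules and their trivial extensions *)

Lemma comodule_of_coassocE (k : fieldType) (H : hopfAlgType k) (M : lmodType k)
    (rho : M -> M ⊗ H) :
  islin rho ->
  (forall m, \tsum_(m0, m1 <- rho m) \tsum_(x, y <- rho m0) (x ⊗ (y ⊗ m1)) =
   \tsum_(m0, m1 <- rho m) \tsum_(x, y <- comul m1) (m0 ⊗ (x ⊗ y))) ->
  (forall m, \tsum_(m0, m1 <- rho m) ((counit m1 : k) *: m0) = m) ->
  comodule rho.
Proof.
move=> rhol rhoA rho1; split=> // m; rewrite rhoA; apply: eq_tsum => x h.
by rewrite -[in RHS](tsum_ext (comul h)) (lin_tsum (g := fun t => x ⊗ t)); last lin.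
Qed.

(** The axioms that turn [bicomodData] into an object of the category of A,A-bimodules in right
    H-comodules. *)
Record is_bicomodule (k : fieldType) (H : hopfAlgType k) (A : comodAlgData H)
    (M : bicomodData A) : Prop := {
  bc_lact_bilinear : is_bilinear (@bc_lact k H A M);
  bc_ract_bilinear : is_bilinear (@bc_ract k H A M);
  bc_lactA : forall (a b : A) (m : M),
    bc_lact a (bc_lact b m) = bc_lact (ca_mul a b) m;
  bc_ractA : forall (m : M) (a b : A),
    bc_ract (bc_ract m a) b = bc_ract m (ca_mul a b);
  bc_actA : forall (a : A) (m : M) (b : A),
    bc_ract (bc_lact a m) b = bc_lact a (bc_ract m b);
  bc_lact1 : forall m : M, bc_lact (ca_one A) m = m;
  bc_ract1 : forall m : M, bc_ract m (ca_one A) = m;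
  bc_comodule : comodule (@bc_coact k H A M);
  bc_coactl : forall (a : A) (m : M), bc_coact (bc_lact a m) =
    \tsum_(a0, a1 <- ca_coact a) \tsum_(m0, m1 <- bc_coact m)
      (bc_lact a0 m0 ⊗ (a1 * m1));
  bc_coactr : forall (m : M) (a : A), bc_coact (bc_ract m a) =
    \tsum_(m0, m1 <- bc_coact m) \tsum_(a0, a1 <- ca_coact a)
      (bc_ract m0 a0 ⊗ (m1 * a1))
}.

Section TrivialExtension.
Variables (k : fieldType) (H : hopfAlgType k) (A : comodAlgData H).
Variable M : bicomodData A.
Hypotheses (AP : is_comodule_algebra A) (MP : is_bicomodule M).

Let Al : islin (@ca_coact _ _ A) := comodule_linear (ca_comodule AP).
Let Ml : islin (@bc_coact _ _ _ M) := comodule_linear (bc_comodule MP).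
Let Ab := ca_mul_bilinear AP.
Let lb := bc_lact_bilinear MP.
Let rb := bc_ract_bilinear MP.
Notation E := (trivial_extension M).

Lemma tsum_trivial_extension (U : lmodType k) (F : E -> H -> U) (x : E) :
  (forall h, islin (fun y => F y h)) -> (forall y, islin (fun h => F y h)) ->
  sweedler (ca_coact x) F =
  \tsum_(a0, a1 <- ca_coact x.1) F (a0, 0) a1 +
  \tsum_(m0, m1 <- bc_coact x.2) F (0, m0) m1.
Proof.
move=> Fl Fr; rewrite /= (islinD (f := fun t => sweedler t F)); last by lin.
rewrite !tsum_tsum; [|lin..].
by congr (_ + _); apply: eq_tsum => v w; rewrite tsum_tensE; lin.
Qed.

Lemma trivial_extension_comodule : comodule (@ca_coact _ _ E).
Proof.
have El : islin (@ca_coact _ _ E) by rewrite /=; lin.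
apply: comodule_of_coassocE => // x; rewrite !tsum_trivial_extension; try by lin.
  congr (_ + _).
    rewrite -(comod_coassocE (ca_comodule AP)
      (F := fun a h h' => ((a, 0) : E) ⊗ (h ⊗ h'))); [|lin..].
    apply: eq_tsum => a h; rewrite tsum_trivial_extension; [|lin..].
    by rewrite (islin0 Ml) (islin0 (f := fun t => sweedler t _)) ?addr0 //; lin.
  rewrite -(comod_coassocE (bc_comodule MP)
    (F := fun a h h' => ((0, a) : E) ⊗ (h ⊗ h'))); [|lin..].
  apply: eq_tsum => a h; rewrite tsum_trivial_extension; [|lin..].
  by rewrite (islin0 Al) (islin0 (f := fun t => sweedler t _)) ?add0r //; lin.
rewrite (comod_counitE (ca_comodule AP) (F := fun a => ((a, 0) : E))); last by lin.
rewrite (comod_counitE (bc_comodule MP) (F := fun a => ((0, a) : E))); last by lin.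
by case: x => a m; congr (_, _); rewrite ?addr0 ?add0r.
Qed.

Lemma trivial_extension_comodule_algebra : is_comodule_algebra E.
Proof.
have Eb : is_bilinear (@ca_mul _ _ E) by rewrite /=; lin.
split=> //.
- move=> [a l] [b m] [c n] /=; rewrite (ca_mulA AP); congr (_, _).
  rewrite (islinD (f := bc_lact a)); last by lin.
  rewrite (islinD (f := fun x => bc_ract x c)); last by lin.
  by rewrite (bc_lactA MP) (bc_actA MP) (bc_ractA MP) addrA.
- move=> [a m] /=; rewrite (ca_mul1l AP) (bc_lact1 MP).
  by rewrite (islin0 (f := fun x => bc_ract x a)) ?addr0 //; lin.
- move=> [a m] /=; rewrite (ca_mul1r AP) (bc_ract1 MP).
  by rewrite (islin0 (f := bc_lact a)) ?add0r //; lin.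
- exact: trivial_extension_comodule.
- rewrite /= (ca_coact1 AP) tsum_tensE; [|lin..].
  by rewrite (islin0 (f := fun m : M => sweedler (bc_coact m) _)) ?addr0 //; lin.
(* The right side splits into four double sums. Those of type A A, A M and M A match the three
   summands on the left; the one of type M M vanishes because [M] has square zero. *)
move=> x y; rewrite !tsum_trivial_extension; [|lin..].
under [X in _ = X + _]eq_tsum => a h.
  rewrite tsum_trivial_extension; [|lin..].
  under eq_tsum => b g.
    rewrite /= (islin0 (f := bc_lact a)); last by lin.
    rewrite (islin0 (f := fun m => bc_ract m b)); last by lin.
    rewrite addr0.
  over.
  under [X in _ + X]eq_tsum => n g.
    rewrite /= (islin0 (f := ca_mul a)); last by lin.
    rewrite (islin0 (f := bc_ract 0)); last by lin.
    rewrite addr0.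
  over.
over.
under [X in _ = _ + X]eq_tsum => m h.
  rewrite tsum_trivial_extension; [|lin..].
  under eq_tsum => b g.
    rewrite /= (islin0 (f := bc_lact 0)); last by lin.
    rewrite (islin0 (f := fun m => ca_mul m b)); last by lin.
    rewrite add0r.
  over.
  under [X in _ + X]eq_tsum => n g.
    rewrite /= (islin0 (f := ca_mul 0)); last by lin.
    rewrite (islin0 (f := fun a => bc_lact a n)); last by lin.
    rewrite (islin0 (f := bc_ract m)); last by lin.
    rewrite addr0 (islin0 (f := fun z : E => z ⊗ (h * g))); last by lin.
  over.
  rewrite tsum0.
over.
rewrite !tsum_addE tsum0 addr0 /= (ca_coactM AP) (islinD _ _ Ml).
rewrite (bc_coactl MP) (bc_coactr MP).
rewrite (islinD (f := fun t => sweedler t _)); last by lin.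
rewrite -addrA; congr (_ + (_ + _)).
- rewrite tsum_tsum; [apply: eq_tsum => a h|lin..].
  by rewrite tsum_tsum; [apply: eq_tsum => b g; rewrite tsum_tensE|..]; lin.
- rewrite tsum_tsum; [apply: eq_tsum => a h|lin..].
  by rewrite tsum_tsum; [apply: eq_tsum => b g; rewrite tsum_tensE|..]; lin.
rewrite tsum_tsum; [apply: eq_tsum => a h|lin..].
by rewrite tsum_tsum; [apply: eq_tsum => b g; rewrite tsum_tensE|..]; lin.
Qed.
End TrivialExtension.

(** * The dual of a comodule algebra as a comodule *)

Lemma linfun_islin (k : fieldType) (V W : vectType k) (f : V -> W) v :
  islin f -> linfun f v = f v.
Proof.
move=> fl; pose L := GRing.isLinear.Build k V W *:%R f fl.
by pose fL : {linear V -> W} := HB.pack f L; rewrite -[LHS]/(linfun fL v) lfunE.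
Qed.

Section DualTensor.
Variables (k : fieldType) (V : vectType k) (W : lmodType k).

(** In finite dimension a tensor is recovered from its values at a basis by means of the dual basis.
    Unlike in [dual_coact_uniq], [W] is arbitrary: coassociativity of [dual_coact] uses [H ⊗ H]. *)
Lemma hom_tensor_eq (s t : ('Hom(V, k^o) ⊗ W)%type) :
  (forall v, \tsum_(f, w <- s) ((f v : k) *: w) =
             \tsum_(f, w <- t) ((f v : k) *: w)) -> s = t.
Proof.
move=> st.
pose e i : 'Hom(V, k^o) := linfun (coord (vbasis {:V}) i : V -> k^o).
suff tE (x : ('Hom(V, k^o) ⊗ W)%type) : x = \sum_(i < \dim {:V}) e i ⊗
    (\tsum_(f, w <- x) ((f (vbasis {:V})`_i : k) *: w)).
  by rewrite (tE s) (tE t); apply: eq_bigr => i _; rewrite st.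
have l (i : 'I_(\dim {:V})) : islin (fun x : ('Hom(V, k^o) ⊗ W)%type => e i ⊗
    (\tsum_(f, w <- x) ((f (vbasis {:V})`_i : k) *: w))) by lin.
rewrite [in RHS](tensor_repr x) [LHS]tensor_repr.
under [RHS]eq_bigr => i _ do rewrite (islin_sum _ _ (l i)).
rewrite exchange_big; apply: eq_bigr => -[f w] _ /=.
under eq_bigr => i _.
  rewrite tsum_tensE; [|lin..].
  rewrite (islinZ (f := fun w => e i ⊗ w)); last by lin.
  rewrite -(islinZ (f := fun g => g ⊗ w)); last by lin.
over.
rewrite -(islin_sum (f := fun g => g ⊗ w)) //; last by lin.
congr (_ ⊗ _); apply/lfunP => a; rewrite sum_lfunE {1}(coord_vbasis (memvf a)).
rewrite linear_sum; apply: eq_bigr => i _.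
by rewrite linearZ scale_lfunE lfunE /= /GRing.scale /= mulrC.
Qed.
End DualTensor.

Section Dual.
Variables (k : fieldType) (H : hopfAlgType k) (A : comodAlgData H).
Hypothesis AP : is_comodule_algebra A.

Let Al : islin (@ca_coact _ _ A) := comodule_linear (ca_comodule AP).
Let Ab := ca_mul_bilinear AP.

Lemma ca_coactME (U : lmodType k) (F : A -> H -> U) a b :
  (forall y, islin (fun x => F x y)) -> (forall x, islin (fun y => F x y)) ->
  \tsum_(c0, c1 <- ca_coact (ca_mul a b)) F c0 c1 =
  \tsum_(a0, a1 <- ca_coact a) \tsum_(b0, b1 <- ca_coact b)
    F (ca_mul a0 b0) (a1 * b1).
Proof.
move=> Fl Fr; rewrite (ca_coactM AP) tsum_tsum //; apply: eq_tsum => g1 g2.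
by rewrite tsum_tsum //; apply: eq_tsum => h1 h2; rewrite tsum_tensE.
Qed.

Lemma dual_act_lin (chi : H -> k^o) :
  islin chi -> islin (dual_act (@ca_coact _ _ A) chi).
Proof. by move=> chil; rewrite /dual_act; lin. Qed.

Lemma dual_act1 (chi : H -> k^o) : islin chi -> chi 1 = 1 ->
  dual_act (@ca_coact _ _ A) chi (ca_one A) = ca_one A.
Proof.
move=> chil chi1; rewrite /dual_act (ca_coact1 AP) tsum_tensE; [|lin..].
by rewrite chi1 scale1r.
Qed.

Lemma dual_actM (chi : H -> k^o) a b : islin chi ->
  {morph chi : x y / x * y} ->
  dual_act (@ca_coact _ _ A) chi (ca_mul a b) =
  ca_mul (dual_act (@ca_coact _ _ A) chi a) (dual_act (@ca_coact _ _ A) chi b).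
Proof.
move=> chil chiM; rewrite /dual_act ca_coactME; [|lin..].
rewrite (lin_tsum (g := fun x => ca_mul x _)); last by lin.
apply: eq_tsum => a0 a1; rewrite (lin_tsum (g := ca_mul _)); last by lin.
apply: eq_tsum => b0 b1; rewrite (islinZ (f := ca_mul _)); last by lin.
rewrite (islinZ (f := fun x => ca_mul x _)); last by lin.
by rewrite chiM scalerA mulrC.
Qed.

(** The characterisation of [dual_coact] pushed through a linear [G]; with it, later computations
    never meet the basis in the definition. *)
Lemma dual_coactE (U : lmodType k) (G : H -> U) (f : dual A) a : islin G ->
  \tsum_(f0, f1 <- dual_coact f) ((f0 a : k) *: G f1) =
  \tsum_(a0, a1 <- ca_coact a) ((f a0 : k) *: G (antipode a1)).
Proof.
move=> Gl; have := congr1 G (dual_coactP f a Al); rewrite !(lin_tsum _ _ Gl) => E.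
transitivity (\tsum_(f0, f1 <- dual_coact f) G ((f0 a : k) *: f1)).
  by apply: eq_tsum => v w; rewrite (islinZ _ _ Gl).
by rewrite E; apply: eq_tsum => v w; rewrite (islinZ _ _ Gl).
Qed.

Lemma dual_coact_lin : islin (@dual_coact _ _ A).
Proof.
move=> c f g; apply: hom_tensor_eq => a.
have l : islin (fun t : dual A ⊗ H => \tsum_(f, w <- t) ((f a : k) *: w)) by lin.
rewrite (islinD _ _ l) (islinZ _ _ l) !(dual_coactE (G := id)); try by lin.
rewrite scale_tsum -tsum_addE; apply: eq_tsum => b h.
by rewrite add_lfunE scale_lfunE scalerDl -scalerA.
Qed.

(** Evaluated at a, both sides of coassociativity are \sum f(a_0) S(a_2) ⊗ S(a_1), since S reverses
    the coproduct. The counit axiom rests on [counit_antipode]. *)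
Lemma dual_comodule : comodule (@dual_coact _ _ A).
Proof.
have dl := dual_coact_lin.
apply: comodule_of_coassocE => // f.
  apply: hom_tensor_eq => a.
  rewrite !tsum_tsum; [|lin..].
  transitivity (\tsum_(a0, a1 <- ca_coact a) \tsum_(b0, b1 <- ca_coact a0)
    ((f b0 : k) *: (antipode a1 ⊗ antipode b1))).
    under eq_tsum => f0 f1.
      rewrite tsum_tsum; [|lin..].
      under eq_tsum => x y do (rewrite tsum_tensE; [|lin..]).
      rewrite (dual_coactE (G := fun y => y ⊗ f1)); last by lin.
    over.
    rewrite tsum_exch; apply: eq_tsum => a0 a1.
    by rewrite (dual_coactE (G := fun y => antipode a1 ⊗ y)); last by lin.
  rewrite (comod_coassocE (ca_comodule AP)
   (F := fun x y z => (f x : k) *: (antipode z ⊗ antipode y))); [|lin..].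
  under [RHS]eq_tsum => f0 f1.
    rewrite tsum_tsum; [|lin..].
    under eq_tsum => x y do (rewrite tsum_tensE; [|lin..]).
    rewrite -scale_tsum tsum_ext.
  over.
  rewrite (dual_coactE (G := fun y => comul y)); last by lin.
  by apply: eq_tsum => x y; rewrite comul_antipode scale_tsum.
apply/lfunP => a.
rewrite (lin_tsum (g := fun f : dual A => f a)); last by lin.
under eq_tsum => f0 f1 do rewrite scale_lfunE /GRing.scale /= mulrC.
rewrite (dual_coactE (U := k^o) (G := fun h => counit h)); last by lin.
under eq_tsum => a0 a1 do rewrite counit_antipode /GRing.scale /= mulrC.
by rewrite (comod_counitE (ca_comodule AP) (U := k^o) (F := fun a => f a)); last by lin.
Qed.
End Dual.

(** * The twisted dual as a bimodule in comodules *)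

Section DualBicomod.
Variables (k : fieldType) (H : hopfAlgType k) (A : comodAlgData H).
Variable u : {lrmorphism H -> k^o}.
Hypotheses (uS : sovereign_character u) (AP : is_comodule_algebra A).

Let Al : islin (@ca_coact _ _ A) := comodule_linear (ca_comodule AP).
Let Ab := ca_mul_bilinear AP.
Let uinv : H -> k^o := conv_inv u.
Let uinvl : islin uinv := conv_inv_lin u.
Let act : A -> A := dual_act (@ca_coact _ _ A) uinv.
Let actl : islin act := dual_act_lin AP uinvl.

Lemma dual_lactE (a b : A) (f : dual A) :
  dual_lact u a f b = f (ca_mul b (act a)).
Proof. by rewrite linfun_islin //; lin. Qed.

Lemma dual_ractE (a b : A) (f : dual A) :
  dual_ract f a b = f (ca_mul a b).
Proof. by rewrite linfun_islin //; lin. Qed.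

Lemma dual_lact_bilinear : is_bilinear (@dual_lact _ _ A u).
Proof.
split=> [f c a a'|a c f f'] /=; apply/lfunP => b.
  rewrite add_lfunE scale_lfunE !dual_lactE.
  by rewrite -[X in _ = X + _](islinZ (f := fun a => f (ca_mul b (act a))))
    -?(islinD (f := fun a => f (ca_mul b (act a)))) //; lin.
by rewrite add_lfunE scale_lfunE !dual_lactE add_lfunE scale_lfunE.
Qed.

Lemma dual_ract_bilinear : is_bilinear (@dual_ract _ _ A).
Proof.
split=> [a c f f'|f c a a'] /=; apply/lfunP => b.
  by rewrite add_lfunE scale_lfunE !dual_ractE add_lfunE scale_lfunE.
rewrite add_lfunE scale_lfunE !dual_ractE.
by rewrite -[X in _ = X + _](islinZ (f := fun a => f (ca_mul a b)))
  -?(islinD (f := fun a => f (ca_mul a b))) //; lin.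
Qed.

Let lb := dual_lact_bilinear.
Let rb := dual_ract_bilinear.

Lemma dual_coactl (a : A) (f : dual A) : dual_coact (dual_lact u a f) =
  \tsum_(a0, a1 <- ca_coact a) \tsum_(f0, f1 <- dual_coact f)
    (dual_lact u a0 f0 ⊗ (a1 * f1)).
Proof.
apply: hom_tensor_eq => b.
rewrite (dual_coactE AP (G := id)) // tsum_tsum; [|lin..].
pose G x b0 b1 h : H := (f (ca_mul b0 x) : k) *: (h * antipode b1).
transitivity (\tsum_(b0, b1 <- ca_coact b) \tsum_(a0, a1 <- ca_coact a)
    ((uinv a1 : k) *: G a0 b0 b1 1)).
  apply: eq_tsum => b0 b1; rewrite dual_lactE /act /dual_act /G.
  rewrite (lin_tsum (g := fun x => (f (ca_mul b0 x) : k) *: antipode b1)); last by lin.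
  apply: eq_tsum => a0 a1; rewrite mul1r.
  by rewrite (islinZ (f := fun x => (f (ca_mul b0 x) : k) *: antipode b1)); last by lin.
rewrite tsum_exch.
(* This is \sum u^-1(a_2) f(b_0 a_0) a_3 S(a_1) S(b_1), the right side evaluated at b once S(b_1
   a_1) is reversed; [conv_inv_antipode] contracts the three legs a_1, a_2, a_3 to u^-1(a_1). *)
transitivity (\tsum_(a0, a1 <- ca_coact a) \tsum_(x, y <- ca_coact a0)
  \tsum_(x0, x1 <- ca_coact x) \tsum_(b0, b1 <- ca_coact b)
    ((uinv y : k) *: G x0 b0 b1 (a1 * antipode x1))).
  rewrite (comod_coassocE (ca_comodule AP) (F := fun x y z =>
   \tsum_(x0, x1 <- ca_coact x) \tsum_(b0, b1 <- ca_coact b)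
    ((uinv y : k) *: G x0 b0 b1 (z * antipode x1)))); [|rewrite /G; lin..].
  under [RHS]eq_tsum => a0 a1 do rewrite tsum_exch.
  rewrite [RHS](comod_coassocE (ca_comodule AP) (F := fun x x1 q =>
   \tsum_(y, z <- comul q) \tsum_(b0, b1 <- ca_coact b)
    ((uinv y : k) *: G x b0 b1 (z * antipode x1)))); [|rewrite /G; lin..].
  apply: eq_tsum => a0 h.
  under [RHS]eq_tsum => x1 q.
    under eq_tsum => y z do rewrite -scale_tsum.
  over.
  rewrite (conv_inv_antipode uS (F := fun t =>
    \tsum_(b0, b1 <- ca_coact b) G a0 b0 b1 t)); last by rewrite /G; lin.
  by rewrite scale_tsum.
apply: eq_tsum => a0 a1; rewrite tsum_tsum; [|lin..].
under [RHS]eq_tsum => f0 f1.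
  rewrite tsum_tensE; [|lin..].
  rewrite dual_lactE.
over.
rewrite (dual_coactE AP (G := fun h => a1 * h)); last by lin.
rewrite /act /dual_act.
rewrite (lin_tsum (g := fun x => \tsum_(c0, c1 <- ca_coact (ca_mul b x))
  ((f c0 : k) *: (a1 * antipode c1)))); last by lin.
apply: eq_tsum => x y.
rewrite (islinZ (f := fun x => \tsum_(c0, c1 <- ca_coact (ca_mul b x))
  ((f c0 : k) *: (a1 * antipode c1)))); last by lin.
rewrite (ca_coactME AP); [|lin..].
rewrite tsum_exch scale_tsum; apply: eq_tsum => x0 x1.
rewrite scale_tsum; apply: eq_tsum => b0 b1.
by rewrite /G antipodeM mulrA.
Qed.

(** At b the right side is \sum f(a_0 b_0) S(a_1 b_1) a_2 = \sum f(a_0 b_0) S(b_1) S(a_1) a_2, and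
    S(a_1) a_2 cancels directly. *)
Lemma dual_coactr (f : dual A) (a : A) : dual_coact (dual_ract f a) =
  \tsum_(f0, f1 <- dual_coact f) \tsum_(a0, a1 <- ca_coact a)
    (dual_ract f0 a0 ⊗ (f1 * a1)).
Proof.
apply: hom_tensor_eq => b.
rewrite (dual_coactE AP (G := id)) // tsum_tsum; [|lin..].
under [RHS]eq_tsum => f0 f1.
  rewrite tsum_tsum; [|lin..].
  under eq_tsum => a0 a1.
    rewrite tsum_tensE; [|lin..].
    rewrite dual_ractE.
  over.
over.
rewrite tsum_exch.
under [RHS]eq_tsum => a0 a1.
  rewrite (dual_coactE AP (G := fun h => h * a1)); last by lin.
  rewrite (ca_coactME AP); [|lin..].
over.
rewrite (comod_coassocE (ca_comodule AP) (F := fun x x1 a1 =>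
  \tsum_(b0, b1 <- ca_coact b)
    ((f (ca_mul x b0) : k) *: (antipode (x1 * b1) * a1)))); [|lin..].
under [RHS]eq_tsum => a0 h.
  under eq_tsum => x1 a1.
    under eq_tsum => b0 b1 do rewrite antipodeM -mulrA.
  over.
  rewrite (antipodelE (F := fun t => \tsum_(b0, b1 <- ca_coact b)
    ((f (ca_mul a0 b0) : k) *: (antipode b1 * t)))); last by lin.
over.
rewrite (comod_counitE (ca_comodule AP) (F := fun a => \tsum_(b0, b1 <- ca_coact b)
    ((f (ca_mul a b0) : k) *: (antipode b1 * 1)))); last by lin.
by apply: eq_tsum => b0 b1; rewrite dual_ractE mulr1.
Qed.

(** The left action is associative and unital because u^-1 is a character, so that a -> u^-1 . a is
    a unital algebra morphism. *)
Lemma dual_bicomod_is_bicomodule : is_bicomodule (dual_bicomod u A).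
Proof.
split=> /=.
- exact: lb.
- exact: rb.
- move=> a b f; apply/lfunP => c; rewrite !dual_lactE.
  by rewrite /act (dual_actM AP _ _ uinvl (conv_invM u)) (ca_mulA AP).
- by move=> f a b; apply/lfunP => c; rewrite !dual_ractE (ca_mulA AP).
- move=> a f b; apply/lfunP => c.
  by rewrite dual_ractE !dual_lactE dual_ractE (ca_mulA AP).
- move=> f; apply/lfunP => c; rewrite dual_lactE.
  by rewrite /act (dual_act1 AP uinvl (conv_inv1 u)) (ca_mul1r AP).
- by move=> f; apply/lfunP => c; rewrite dual_ractE (ca_mul1l AP).
- exact: dual_comodule.
- exact: dual_coactl.
- exact: dual_coactr.
Qed.
End DualBicomod.

(** * Symmetry from a Frobenius form *)

Lemma bicomod_morphism_inv (k : fieldType) (H : hopfAlgType k)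
    (A : comodAlgData H) (M N : bicomodData A) (f : M -> N) (g : N -> M) :
  islin (@bc_coact _ _ _ M) ->
  bicomod_morphism f -> cancel f g -> cancel g f -> bicomod_morphism g.
Proof.
move=> Ml [fl fL fR fC] fK gK; have finj := can_inj fK.
have {}fl : islin f by [].
have gl : islin g.
  by move=> a x y; apply: finj; rewrite fl !gK.
split=> // [a m|m a|m]; try by apply: finj; rewrite ?fL ?fR !gK.
rewrite -[in RHS](gK m) fC tsum_tsum; [|lin..].
under eq_tsum => x h do (rewrite tsum_tensE; [rewrite fK|lin..]).
by rewrite tsum_ext.
Qed.

Lemma hom_bijective (k : fieldType) (V W : vectType k) (f : V -> W) :
  islin f -> (forall v, f v = 0 -> v = 0) -> \dim {:V} = \dim {:W} ->
  exists g, cancel f g /\ cancel g f.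
Proof.
move=> fl f0 dVW; pose F := linfun f.
have FE v : F v = f v by exact: linfun_islin.
have kerF : lker F == 0%VS.
  apply/eqP/vspaceP => v; rewrite memv_ker memv0 FE.
  by apply/eqP/eqP => [/f0|->] //; rewrite islin0.
have imF : limg F = fullv.
  apply/eqP; rewrite eqEdim subvf -dVW /=.
  by rewrite -(limg_ker_dim F fullv) (eqP kerF) capv0 dimv0 add0n.
exists (F^-1)%VF; split=> [v|w]; first by rewrite -FE lker0_lfunK.
by rewrite -FE limg_lfunVK // imF memvf.
Qed.

Section Frobenius.
Variables (k : fieldType) (H : hopfAlgType k) (A : comodAlgData H).
Variable u : {lrmorphism H -> k^o}.
Hypotheses (AP : is_comodule_algebra A).

Let Al : islin (@ca_coact _ _ A) := comodule_linear (ca_comodule AP).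
Let Ab := ca_mul_bilinear AP.

(** The isomorphism is x -> lam(x -). It is right linear by associativity, left linear by the
    twisted symmetry, colinear because [lam] is, and bijective by nondegeneracy and equality of
    dimensions. *)
Lemma symmetric_of_form (lam : dual A) :
  (forall x, \tsum_(x0, x1 <- ca_coact x) ((lam x0 : k) *: x1) =
             (lam x : k) *: 1) ->
  (forall x y, lam (ca_mul x y) =
     lam (ca_mul y (dual_act (@ca_coact _ _ A) (conv_inv u) x))) ->
  (forall x, (forall y, lam (ca_mul x y) = 0) -> x = 0) ->
  symmetric_comodule_algebra u A.
Proof.
move=> lamC lamT lamN.
have rb := dual_ract_bilinear AP.
pose f := dual_ract lam.
have fl : islin f by rewrite /f; lin.
have fE x y : f x y = lam (ca_mul x y) by rewrite /f dual_ractE.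
have f0 x : f x = 0 -> x = 0.
  by move=> /lfunP fx0; apply: lamN => y; rewrite -fE fx0 zero_lfunE.
have dA : \dim {:A} = \dim {:dual A} by rewrite !dimvf /dim /= muln1.
have [g [fK gK]] := hom_bijective fl f0 dA.
have fM : bicomod_morphism (f : regular_bicomod A -> dual_bicomod u A).
  split=> //= [a x|x a|x].
  - apply/lfunP => y.
    by rewrite dual_lactE // !fE -!(ca_mulA AP) lamT (ca_mulA AP).
  - by apply/lfunP => y; rewrite dual_ractE // !fE (ca_mulA AP).
  apply: hom_tensor_eq => y.
  rewrite (dual_coactE AP (G := id)) // tsum_tsum; [|lin..].
  under [RHS]eq_tsum => x0 x1 do (rewrite tsum_tensE; [rewrite fE|lin..]).
  (* Both sides equal \sum lam(x_0 y_0) x_1 y_1 S(y_2): colinearity of [lam] at x y_0 gives the left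
     one, and cancelling y_1 S(y_2) the right one. *)
  transitivity (\tsum_(x0, x1 <- ca_coact x) \tsum_(y0, y1 <- ca_coact y)
      \tsum_(z0, z1 <- ca_coact y0)
      ((lam (ca_mul x0 z0) : k) *: (x1 * z1 * antipode y1))).
    rewrite tsum_exch; apply: eq_tsum => y0 y1.
    rewrite -(ca_coactME AP (F := fun w h => (lam w : k) *: (h * antipode y1)));
      [|lin..].
    under [RHS]eq_tsum => w h do rewrite scalerAl.
    by rewrite -tsum_mull lamC -scalerAl mul1r fE.
  apply: eq_tsum => x0 x1.
  rewrite (comod_coassocE (ca_comodule AP) (F := fun z0 z1 y1 =>
    (lam (ca_mul x0 z0) : k) *: (x1 * z1 * antipode y1))); [|lin..].
  under eq_tsum => y0 h.
    under eq_tsum => z1 y1 do rewrite -mulrA.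
    rewrite (antipoderE (F := fun t => (lam (ca_mul x0 y0) : k) *: (x1 * t)));
      last by lin.
    rewrite mulr1.
  over.
  by rewrite (comod_counitE (ca_comodule AP)
    (F := fun y => (lam (ca_mul x0 y) : k) *: x1)); last by lin.
exists g, f; split=> //; apply: (bicomod_morphism_inv _ fM) => //.
Qed.
End Frobenius.

Lemma dual_separates (k : fieldType) (V : vectType k) (v : V) :
  (forall f : 'Hom(V, k^o), f v = 0) -> v = 0.
Proof.
move=> fv0; rewrite (coord_vbasis (memvf v)) big1 // => i _.
have := fv0 (linfun (coord (vbasis {:V}) i : V -> k^o)).
by rewrite lfunE /= => ->; rewrite scale0r.
Qed.

(** * The Frobenius form of the trivial extension *)

Section TrivialExtensionForm.
Variables (k : fieldType) (H : hopfAlgType k) (A : comodAlgData H).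
Variable u : {lrmorphism H -> k^o}.
Hypotheses (uS : sovereign_character u) (AP : is_comodule_algebra A).

Let Al : islin (@ca_coact _ _ A) := comodule_linear (ca_comodule AP).
Let Ab := ca_mul_bilinear AP.
Let uinvl : islin (conv_inv u : H -> k^o) := conv_inv_lin u.
Let ul : islin u := islin_can u.
Let actl := dual_act_lin AP uinvl.
Let MP := dual_bicomod_is_bicomodule uS AP.
Let dl := dual_coact_lin AP.
Notation act := (dual_act (@ca_coact _ _ A) (conv_inv u)).
Notation E := (trivial_extension (dual_bicomod u A)).

(** Composing the two actions convolves u with u^-1, which is the counit. This gives the injectivity
    used for nondegeneracy. *)
Lemma dual_act_conv_invK : cancel act (dual_act (@ca_coact _ _ A) u).
Proof.
move=> a; rewrite [act a]/dual_act.
rewrite (lin_tsum (g := dual_act _ u)); last by apply: dual_act_lin.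
under eq_tsum => a0 a1.
  rewrite (islinZ (f := dual_act _ u)); last by apply: dual_act_lin.
  rewrite /dual_act scale_tsum.
  under eq_tsum => x y do rewrite scalerA mulrC -scalerA.
over.
rewrite (comod_coassocE (ca_comodule AP)
  (F := fun x y z => (u y : k) *: ((conv_inv u z : k) *: x))); [|lin..].
under eq_tsum => a0 h do
 (rewrite (character_antipoder (chi := u)); [|lin|exact: rmorph1|exact: rmorphM]).
by rewrite (comod_counitE (ca_comodule AP) (F := id)).
Qed.

(** By definition of the dual coaction the left side is \sum f(b_0) u^-1(S(b_1)) u^-1(b_2), and the
    two scalars cancel because u^-1 is a character. *)
Lemma dual_act_pairing (f : dual A) (b : A) :
  dual_act (@dual_coact _ _ A) (conv_inv u) f (act b) = f b.
Proof.
rewrite {1}/dual_act (lin_tsum (g := fun f : dual A => f (act b))); last by lin.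
under eq_tsum => f0 f1 do rewrite scale_lfunE /GRing.scale /= mulrC.
rewrite (dual_coactE AP (U := k^o) (G := fun h => conv_inv u h : k^o));
  last by lin.
rewrite [act b]/dual_act.
rewrite (lin_tsum (g := fun x => \tsum_(a0, a1 <- ca_coact x)
  ((f a0 : k) *: (conv_inv u (antipode a1) : k^o)))); last by lin.
under eq_tsum => b0 b1.
  rewrite (islinZ (f := fun x => \tsum_(a0, a1 <- ca_coact x)
    ((f a0 : k) *: (conv_inv u (antipode a1) : k^o)))); last by lin.
  rewrite scale_tsum.
  under eq_tsum => x y do rewrite [_ *: (conv_inv u _ : k^o)]mulrC [_ *: _]mulrCA.
over.
rewrite (comod_coassocE (ca_comodule AP) (U := k^o) (F := fun x y z =>
  (conv_inv u (antipode y) : k) *: ((conv_inv u z : k) *: f x))); [|lin..].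
under eq_tsum => b0 h do
 (rewrite (character_antipodel (U := k^o) (chi := conv_inv u));
   [|exact: uinvl|exact: (conv_inv1 u)|exact: (conv_invM u)]).
by rewrite (comod_counitE (ca_comodule AP) (U := k^o) (F := fun b => f b)); last lin.
Qed.

Lemma trivial_extension_dual_act (x : E) :
  dual_act (@ca_coact _ _ E) (conv_inv u) x =
  (act x.1, dual_act (@dual_coact _ _ A) (conv_inv u) x.2).
Proof.
rewrite {1}/dual_act tsum_trivial_extension; [|lin..].
rewrite [RHS](_ : _ = ((act x.1, 0) : E) +
    (0, dual_act (@dual_coact _ _ A) (conv_inv u) x.2)); last first.
  by congr (_, _); rewrite ?addr0 ?add0r.
rewrite [in RHS]/dual_act (lin_tsum (g := fun a => (a, 0) : E)); last by lin.
rewrite (lin_tsum (g := fun f => (0, f) : E)); last by lin.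
by congr (_ + _); apply: eq_tsum => y h; congr (_, _); rewrite /= scaler0.
Qed.

Lemma trivial_extension_symmetric : symmetric_comodule_algebra u E.
Proof.
pose lam : dual E := linfun (fun x : E => x.2 (ca_one A)).
have lamE x : lam x = x.2 (ca_one A) by rewrite /lam linfun_islin //; lin.
apply: (symmetric_of_form (trivial_extension_comodule_algebra AP MP) (lam := lam)).
(* Only the dual component contributes: \sum f_0(1) f_1 = f(1) S(1) = f(1) 1. *)
- case=> a f; rewrite tsum_trivial_extension; [|lin..].
  under eq_tsum => a0 h do rewrite lamE zero_lfunE scale0r.
  under [X in _ + X]eq_tsum => a0 h do rewrite lamE.
  rewrite tsum0 add0r (dual_coactE AP (G := id)) // (ca_coact1 AP).
  by rewrite tsum_tensE ?antipode1 ?lamE //; lin.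
(* The left side is g(u^-1 . a) + f(b), the right side (u^-1 . f)(u^-1 . b) + g(u^-1 . a). *)
- case=> a f [b g]; rewrite !lamE trivial_extension_dual_act /=.
  rewrite !add_lfunE !dual_lactE // !dual_ractE // !(ca_mul1l AP) !(ca_mul1r AP).
  by rewrite dual_act_pairing addrC.
case=> a f fN; congr (_, _).
  (* Testing against (0, g) gives g(u^-1 . a) = 0 for every g; testing against (b, 0) below gives
     f(b) = 0. *)
  apply: (can_inj dual_act_conv_invK); rewrite (islin0 actl).
  apply: dual_separates => g; have := fN (0, g).
  rewrite lamE /= add_lfunE dual_lactE // dual_ractE // (ca_mul1l AP).
  by rewrite (islin0 (f := fun x => f (ca_mul x _))) ?addr0 //; lin.
apply/lfunP => b; rewrite zero_lfunE; have := fN (b, 0).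
rewrite lamE /= add_lfunE dual_lactE // dual_ractE // (ca_mul1r AP).
by rewrite zero_lfunE add0r.
Qed.
End TrivialExtensionForm.

Theorem proposition2p6 (k : fieldType) (H : hopfAlgType k)
    (u : {lrmorphism H -> k^o}) (A : comodAlgData H) :
  sovereign_character u ->
  is_comodule_algebra A ->
  is_comodule_algebra (trivial_extension (dual_bicomod u A)) /\
  symmetric_comodule_algebra u (trivial_extension (dual_bicomod u A)).
Proof.
move=> uS AP; split; last exact: trivial_extension_symmetric.
exact: trivial_extension_comodule_algebra (dual_bicomod_is_bicomodule uS AP).
Qed.
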